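(* Let $k,n$ be integers with $3\le k\le n$, and let $G$ be a connected graph of order $n$. Then (1) $0\le \tau_k(G)+\tau_k(\bar G)\le n-k$; (2) $0\le \tau_k(G)\cdot\tau_k(\bar G)\le \left\lfloor\frac{n-k}{2}\right\rfloor^2$. Moreover, the upper and lower bounds are sharp.
   Context: $\bar G$ is the complement of $G$. For $S\subseteq V(G)$ with $|S|\ge 2$, a pedant $S$-Steiner tree is a subgraph of $G$ that is a tree containing $S$ in which every vertex of $S$ has degree exactly one. Two pedant $S$-Steiner trees $T,T'$ are internally disjoint if $E(T)\cap E(T')=\emptyset$ and $V(T)\cap V(T')=S$. $\tau_G(S)$ is the maximum number of pairwise internally disjoint pedant $S$-Steiner trees in $G$, and $\tau_k(G)=\min\{\tau_G(S): S\subseteq V(G),\ |S|=k\}$; by convention $\tau_k(G)=0$ when $G$ is disconnected.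
   Formalization: Sharpness of the upper bound in (2) is stated only as: for every k≥3 some n≥k and connected G attain it (shown at n=k, both sides 0); for n≥k+2 no graph attains it, e.g. k=3, n=5 has bound 1 but product always 0. *)

(* Defs.v *)
From mathcomp Require Import all_boot.

Set Implicit Arguments.
Unset Strict Implicit.
Unset Printing Implicit Defensive.

Record sgraph := SGraph {
  vertex :> finType;
  adj : rel vertex;
  adj_sym : symmetric adj;
  adj_irr : irreflexive adj }.

Section Complement.
Variable G : sgraph.

Definition compl_adj : rel G := [rel x y | (x != y) && ~~ adj x y].

Fact compl_adj_sym : symmetric compl_adj.
Proof. by move=> x y; rewrite /compl_adj /= adj_sym (eq_sym x y). Qed.

Fact compl_adj_irr : irreflexive compl_adj.
Proof. by move=> x; rewrite /compl_adj /= eqxx. Qed.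

Definition compl : sgraph := SGraph compl_adj_sym compl_adj_irr.

End Complement.

Definition connected_graph (G : sgraph) : bool :=
  [forall x : G, forall y : G, connect (@adj G) x y].

Section Subgraphs.
Variable G : sgraph.

(* An edge is an unordered pair, encoded as a two-element vertex set. *)
Definition edges : {set {set G}} :=
  [set e : {set G} | [exists x, exists y, adj x y && (e == [set x; y])]].

(* A pair (V(H), E(H)); it denotes a subgraph when is_subgraph holds. *)
Definition presubgraph : finType := ({set G} * {set {set G}})%type.

Implicit Types (H : presubgraph) (S : {set G}).

Definition is_subgraph H : bool :=
  (H.2 \subset edges) && [forall e in H.2, e \subset H.1].

Definition sub_adj H : rel G := [rel x y | [set x; y] \in H.2].

Definition sub_connected H : bool :=
  [forall x in H.1, forall y in H.1, connect (sub_adj H) x y].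

(* A cycle has pairwise distinct vertices, hence length at most #|G|: bounding
   the length makes the quantification over cycles finite. The condition 2 < m
   discards the closed walks of length 2 along a single edge. *)
Definition sub_acyclic H : bool :=
  [forall m : 'I_#|G|.+1, forall c : m.-tuple G,
     (2 < m) ==> ~~ ucycleb (sub_adj H) c].

Definition is_tree H : bool :=
  [&& is_subgraph H, H.1 != set0, sub_connected H & sub_acyclic H].

Definition sub_degree H (x : G) : nat := #|[set e in H.2 | x \in e]|.

Definition pedant_steiner_tree S H : bool :=
  [&& is_tree H, S \subset H.1 & [forall x in S, sub_degree H x == 1]].

Definition internally_disjoint S H1 H2 : bool :=
  (H1.2 :&: H2.2 == set0) && (H1.1 :&: H2.1 == S).

Definition pedant_packing S (F : {set presubgraph}) : bool :=
  [forall H in F, pedant_steiner_tree S H] &&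
  [forall H1 in F, forall H2 in F,
     (H1 != H2) ==> internally_disjoint S H1 H2].

Definition tau_set S : nat :=
  \max_(F : {set presubgraph} | pedant_packing S F) #|F|.

(* The fallback value 0 is also used when G has fewer than k vertices, in which
   case there is no set to minimize over. *)
Definition tau (k : nat) : nat :=
  if ~~ connected_graph G then 0
  else if [pick S : {set G} | #|S| == k] is Some S0
  then tau_set [arg min_(S < S0 | #|S| == k) tau_set S]
  else 0.

End Subgraphs.

(* Main.v *)
Require Import Defs.
From mathcomp Require Import all_boot.

(** For [s] in [S], every pedant [S]-Steiner tree joins [s] to a vertex outside
    [S], and internally disjoint trees use distinct such vertices; so
    [tau_set S] is at most the number of neighbours of [s] outside [S]. Adding
    the bounds for [G] and its complement gives the bound on the sum.
    If the sum equals [n - k], both bounds are attained for all [S] and [s];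
    exchanging a vertex of [S] other than [s] with a vertex outside [S] then
    shows that [s] is adjacent to all other vertices or to none, so one of the
    two parameters vanishes. Otherwise the sum is less than [n - k], and AM-GM
    gives the bound on the product.
    Star graphs attain the lower bounds and complete graphs the upper bound on
    the sum. *)

Set Implicit Arguments.
Unset Strict Implicit.
Unset Printing Implicit Defensive.

Lemma leq_add_eq a b x y :
  x + y = a + b -> a <= x -> b <= y -> x = a /\ y = b.
Proof.
move=> E le_ax le_by; split; apply/eqP; rewrite eqn_leq ?le_ax ?le_by andbT.
  by rewrite -(leq_add2r b) -E leq_add2l.
by rewrite -(leq_add2l a) -E leq_add2r.
Qed.

(** * Bounding [tau_set] from above by outer neighbours *)

Section Bounds.
Variable G : sgraph.
Implicit Types (S : {set G}) (H : presubgraph G) (k : nat).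

Definition outer_nbrs S (s : G) : {set G} := [set v in ~: S | adj s v].

Lemma sub_degree1_eq H (x : G) (e f : {set G}) :
  sub_degree H x == 1 -> e \in H.2 -> f \in H.2 -> x \in e -> x \in f -> e = f.
Proof.
move/cards1P=> [g Eg] He Hf xe xf.
have: e \in [set g] by rewrite -Eg inE He.
have: f \in [set g] by rewrite -Eg inE Hf.
by move=> /set1P-> /set1P->.
Qed.

(** The vertex is the other end of the only tree edge at [s]. The bound [2 < #|S|] excludes the tree
    that is a single edge joining the two vertices of [S]. *)
Lemma pedant_steiner_tree_outer_nbr S H (s : G) :
  2 < #|S| -> s \in S -> pedant_steiner_tree S H ->
  exists2 v, v \in H.1 & v \in outer_nbrs S s.
Proof.
move=> S3 sS /and3P[/and4P[/andP[Hedges /forall_inP HV] _ /forall_inP Hcon _]].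
move=> /subsetP SH /forall_inP Hdeg.
have /cards1P[e0 Ee0] := Hdeg s sS.
have: e0 \in [set e in H.2 | s \in e] by rewrite Ee0 set11.
rewrite inE => /andP[He0 se0].
have [y sy Ey] : exists2 y, adj s y & e0 = [set s; y].
  have := subsetP Hedges _ He0; rewrite inE.
  case/existsP=> x /existsP[y /andP[xy /eqP Exy]].
  move: se0; rewrite Exy => /set2P[->|->]; first by exists y.
  by exists x; [rewrite adj_sym | rewrite setUC].
have yH : y \in H.1 by apply: (subsetP (HV _ He0)); rewrite Ey set22.
exists y => //; rewrite !inE sy andbT; apply/negP=> yS.
(* An edge of the tree inside [S] would be a whole component of it. *)
have closed_sy : closed (sub_adj H) (mem [set s; y]).
  apply: intro_closed => [|a b].
    by apply: sym_connect_sym => a b; rewrite /sub_adj /= setUC.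
  rewrite /sub_adj /= => Hab asy.
  have aS : a \in S by case/set2P: asy => ->.
  have -> : [set s; y] = [set a; b].
    by apply: (sub_degree1_eq (Hdeg a aS)); rewrite -?Ey // ?Ey ?set21.
  exact: set22.
have sub : S \subset [set s; y].
  apply/subsetP=> t tS.
  have := closed_connect closed_sy (forall_inP (Hcon s (SH s sS)) t (SH t tS)).
  by rewrite set21 => /esym.
by have := leq_trans S3 (subset_leq_card sub); rewrite cards2; case: (s != y).
Qed.

Lemma tau_set_le_outer_nbrs S (s : G) :
  2 < #|S| -> s \in S -> tau_set S <= #|outer_nbrs S s|.
Proof.
move=> S3 sS; apply/bigmax_leqP=> F /andP[/forall_inP FS /forall_inP FD].
(* The default [s] is never taken for [H] in [F], by [fP]. *)
pose f H := odflt s [pick v in H.1 :&: outer_nbrs S s].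
have fP H : H \in F -> (f H \in H.1) && (f H \in outer_nbrs S s).
  move=> HF; rewrite /f; case: pickP => [v|no]; first by rewrite !inE.
  have [v vH vo] := pedant_steiner_tree_outer_nbr S3 sS (FS _ HF).
  by have := no v; rewrite inE vH vo.
rewrite -(@card_in_imset _ _ f).
  apply/subset_leq_card/subsetP=> _ /imsetP[H HF ->].
  by have /andP[] := fP _ HF.
(* Distinct trees of the packing meet only in [S], while [f H1] lies outside [S]. *)
move=> H1 H2 F1 F2 Ef; apply/eqP; apply/negPn/negP=> neq.
have /andP[_ /eqP D] := implyP (forall_inP (FD _ F1) _ F2) neq.
have /andP[v1 vo] := fP _ F1; have /andP[v2 _] := fP _ F2.
have: f H1 \in S by rewrite -D inE v1 Ef v2.
by move: vo; rewrite !inE => /andP[/negP].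
Qed.

(** The exchange loses the outer neighbour [w]; the only vertex it puts outside is [t], which is not
    a neighbour of [s]. *)
Lemma outer_nbrs_exchange S (s t w : G) :
  t \in S -> w \in outer_nbrs S s -> ~~ adj s t ->
  #|outer_nbrs (w |: S :\ t) s| < #|outer_nbrs S s|.
Proof.
move=> tS wo st; apply/proper_card/properP; split; last first.
  by exists w => //; rewrite !inE eqxx.
apply/subsetP=> v; rewrite !inE negb_or negb_and negbK.
case/andP=> /andP[_ /orP[/eqP->|->//]].
by rewrite (negPf st).
Qed.

Lemma card_exchange S (t w : G) :
  t \in S -> w \notin S -> #|w |: S :\ t| = #|S|.
Proof. by move=> tS wS; rewrite cardsU1 !inE (negPf wS) andbF (cardsD1 t S) tS. Qed.

Lemma tau_le_tau_set k S : #|S| = k -> tau G k <= tau_set S.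
Proof.
move=> Sk; rewrite /tau; case: ifP => // _.
case: pickP => [S0 S0k|//]; case: arg_minnP => // S1 _; apply.
exact/eqP.
Qed.

Lemma tau_le_outer_nbrs k S (s : G) :
  2 < k -> #|S| = k -> s \in S -> tau G k <= #|outer_nbrs S s|.
Proof.
move=> k3 Sk sS; apply: leq_trans (tau_le_tau_set Sk) _.
by apply: tau_set_le_outer_nbrs => //; rewrite Sk.
Qed.

Lemma tau_disconnected k : ~~ connected_graph G -> tau G k = 0.
Proof. by rewrite /tau => ->. Qed.

Lemma exists_set_card k : k <= #|G| -> exists S, #|S| = k.
Proof.
rewrite -bin_gt0 -card_draws card_gt0 => /set0Pn[S].
by rewrite inE => /eqP Sk; exists S.
Qed.

Lemma leq_tau k m :
  connected_graph G -> k <= #|G| -> (forall S, #|S| = k -> m <= tau_set S) ->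
  m <= tau G k.
Proof.
move=> cG kG mS; rewrite /tau cG /=; case: pickP => [S0 S0k|no].
  by case: arg_minnP => // S1 /eqP S1k _; apply: mS.
(* A set of size [k] exists, so the fallback value 0 of [tau] is not reached. *)
have [S /eqP Sk] := exists_set_card kG.
by have := no S; rewrite Sk.
Qed.

(** * Stars as pedant Steiner trees, for lower bounds on [tau_set] *)

Definition star S (v : G) : presubgraph G :=
  (v |: S, [set [set s; v] | s in S]).

Lemma star_adj S (v x y : G) :
  sub_adj (star S v) x y -> (x == v) || (y == v).
Proof.
case/imsetP=> s _ /setP /(_ v); rewrite !inE eqxx orbT.
by rewrite (eq_sym v x) (eq_sym v y).
Qed.

Lemma star_acyclic S (v : G) : sub_acyclic (star S v).
Proof.
apply/forallP=> m; apply/forallP=> -[c /= /eqP <-]; apply/implyP => c3.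
apply/negP=> /andP[].
case: c c3 => [|x0 [|x1 [|x2 c]]] //= _ /and3P[/star_adj e01 /star_adj e12].
move=> p2 /and3P[]; rewrite !inE !negb_or.
move=> /and3P[n01 n02 n0c] /andP[n12 n1c] _.
(* The center is on both edges [x0 x1] and [x1 x2], so it is [x1], but the next
   edge of the cycle does not contain [x1]. *)
have Ev : x1 = v.
  case/orP: e01 => /eqP // E0; case/orP: e12 => /eqP // E2.
  by rewrite E0 E2 eqxx in n02.
(* From [x2] the cycle returns to [x0] if it has length 3, and goes on to [x3] otherwise. *)
case: c n0c n1c p2 => [_ _|x3 c _ n1c] /= /andP[/star_adj].
  by rewrite -Ev ![_ == x1]eq_sym (negPf n12) -[x1 == x0]eq_sym (negPf n01).
rewrite -Ev ![_ == x1]eq_sym (negPf n12) /=.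
by move: n1c; rewrite inE negb_or => /andP[/negPf->].
Qed.

Lemma star_pedant S (v : G) :
  v \notin S -> {in S, forall s, adj s v} -> pedant_steiner_tree S (star S v).
Proof.
move=> vS Sv; apply/and3P; split; last first.
- apply/forall_inP=> s sS; apply/cards1P; exists [set s; v].
  apply/setP=> e; rewrite !inE; apply/andP/eqP => [[]|->]; last first.
    by rewrite set21; split=> //; apply/imsetP; exists s.
  case/imsetP=> t _ ->; rewrite !inE => /orP[/eqP->//|/eqP Es].
  by rewrite Es (negPf vS) in sS.
- exact: subsetUr.
apply/and4P; split.
- apply/andP; split.
    apply/subsetP=> _ /imsetP[s sS ->]; rewrite inE.
    by apply/existsP; exists s; apply/existsP; exists v; rewrite Sv /=.
  apply/forall_inP=> _ /imsetP[s sS ->]; apply/subsetP=> x.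
  by rewrite !inE => /orP[/eqP->|->//]; rewrite sS orbT.
- by apply/set0Pn; exists v; apply: setU11.
- have sym : connect_sym (sub_adj (star S v)).
    by apply: sym_connect_sym => a b; rewrite /sub_adj /= setUC.
  have cv x : x \in v |: S -> connect (sub_adj (star S v)) x v.
    case/setU1P=> [->|xS]; first exact: connect0.
    by apply: connect1; apply/imsetP; exists x.
  apply/forall_inP=> x xH; apply/forall_inP=> y yH.
  by apply: connect_trans (cv x xH) _; rewrite sym cv.
exact: star_acyclic.
Qed.

Lemma star_internally_disjoint S (u v : G) :
  u \notin S -> v \notin S -> u != v ->
  internally_disjoint S (star S u) (star S v).
Proof.
move=> uS vS uv; apply/andP; split.
  (* A common edge [[set t; v]] would contain [u], forcing [u = t], which lies in [S]. *)
  rewrite setI_eq0; apply/pred0P => e /=; apply/negP.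
  case/andP=> /imsetP[s _ ->] /imsetP[t tS /setP /(_ u)].
  rewrite !inE eqxx orbT (negPf uv) orbF => /esym /eqP Eu.
  by rewrite Eu tS in uS.
apply/eqP/setP=> x; rewrite !inE -orb_andl.
case: (altP (x =P u)) => [->|_]; last by case: (x \in S); rewrite ?orbT ?orbF.
by rewrite (negPf uv) (negPf uS).
Qed.

(** Each common neighbour outside [S] is the centre of a star, and distinct centres give internally
    disjoint stars. *)
Lemma card_common_nbrs_le_tau_set S :
  #|[set v in ~: S | [forall s in S, adj s v]]| <= tau_set S.
Proof.
set A := [set v in _ | _].
have AP v : v \in A -> v \notin S /\ {in S, forall s, adj s v}.
  by rewrite !inE => /andP[? /forall_inP].
have star_inj : {in A &, injective (star S)}.
  move=> u v /AP[uS _] _ [/setP /(_ u)]; rewrite setU11 !inE (negPf uS) orbF.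
  by move=> /esym/eqP.
rewrite -(card_in_imset star_inj).
apply: leq_bigmax_cond; apply/andP; split.
  apply/forall_inP=> _ /imsetP[v /AP[vS Sv] ->]; exact: star_pedant.
apply/forall_inP=> _ /imsetP[u /AP[uS _] ->].
apply/forall_inP=> _ /imsetP[v /AP[vS _] ->].
apply/implyP=> neq; apply: star_internally_disjoint => //.
by apply: contraNneq neq => ->.
Qed.

End Bounds.

(** * Sum and product for a graph and its complement *)

Section Complement.
Variables (G : sgraph) (k : nat).
Hypotheses (k3 : 2 < k) (kG : k <= #|G|).
Implicit Types S : {set G}.

(** A vertex outside [S] differs from [s], so it is adjacent to [s] in exactly one of the two
    graphs. *)
Lemma card_outer_nbrs_compl S (s : G) : s \in S ->
  #|outer_nbrs S s| + #|@outer_nbrs (compl G) S s| = #|G| - #|S|.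
Proof.
move=> sS; rewrite -(cardsC S) addKn -[RHS](cardsID [set v | adj s v]).
congr (_ + _); apply: eq_card => v; rewrite !inE //=.
rewrite /compl_adj /=; case: (altP (s =P v)) => [<-|_]; last by rewrite andbC.
by rewrite sS /= andbF.
Qed.

Lemma tau_compl_sum : tau G k + tau (compl G) k <= #|G| - k.
Proof.
have [S Sk] := exists_set_card kG.
have /card_gt0P[s sS] : 0 < #|S| by rewrite Sk (ltn_trans _ k3).
rewrite -Sk -(card_outer_nbrs_compl sS) Sk.
by apply: leq_add; apply: tau_le_outer_nbrs.
Qed.

Lemma tau_compl_sum_eq :
  tau G k + tau (compl G) k = #|G| - k -> tau G k * tau (compl G) k = 0.
Proof.
move=> tauE; apply/eqP; rewrite -leqn0 leqNgt muln_gt0; apply/negP.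
case/andP=> tau_pos tauC_pos.
have tight S s : #|S| = k -> s \in S ->
    #|outer_nbrs S s| = tau G k /\
    #|@outer_nbrs (compl G) S s| = tau (compl G) k.
  move=> Sk sS; have := card_outer_nbrs_compl sS; rewrite Sk -tauE => E.
  have le1 := @tau_le_outer_nbrs G k S s k3 Sk sS.
  have le2 := @tau_le_outer_nbrs (compl G) k S s k3 Sk sS.
  exact: leq_add_eq E le1 le2.
have [S Sk] := exists_set_card kG.
have /card_gt1P[s [t [sS tS st]]] : 1 < #|S| by rewrite Sk ltnW.
have swapk w : w \in ~: S -> #|w |: S :\ t| = k.
  by rewrite inE => wS; rewrite card_exchange.
have swaps w : s \in w |: S :\ t by rewrite !inE st sS orbT.
have [E EC] := tight S s Sk sS.
(* The exchange is made in the graph where [s] and [t] are not adjacent; [w] exists there because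
   its parameter is positive. The count drops, against [tight]. *)
have [ast|nast] := boolP (adj s t).
  have /card_gt0P[w wo] : 0 < #|@outer_nbrs (compl G) S s| by rewrite EC.
  have wS : w \in ~: S by case/setIdP: wo.
  have [_ EC'] := tight _ _ (swapk w wS) (swaps w).
  have := @outer_nbrs_exchange (compl G) S s t w tS wo.
  by rewrite EC' EC ltnn /= /compl_adj /= ast andbF => /(_ isT).
have /card_gt0P[w wo] : 0 < #|outer_nbrs S s| by rewrite E.
have wS : w \in ~: S by case/setIdP: wo.
have [E' _] := tight _ _ (swapk w wS) (swaps w).
by have := outer_nbrs_exchange tS wo nast; rewrite E' E ltnn.
Qed.

Lemma tau_compl_prod :
  tau G k * tau (compl G) k <= ((#|G| - k) %/ 2) ^ 2.
Proof.
have := tau_compl_sum; rewrite leq_eqVlt => /orP[/eqP/tau_compl_sum_eq->//|].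
set N := #|G| - k; set a := tau G k; set b := tau _ k => abN.
(* Strictness matters for odd [N]: it gives [a + b <= N - 1]. *)
have ab2 : a + b <= 2 * (N %/ 2).
  rewrite -ltnS (leq_trans abN) // {1}(divn_eq N 2) mulnC -[(_ * _).+1]addn1 leq_add2l.
  by rewrite -ltnS ltn_mod.
rewrite -(@leq_pmul2l 4) // (leq_trans (nat_AGM2 a b)) //.
by rewrite -[4]/(2 ^ 2) -expnMn leq_exp2r.
Qed.

End Complement.

(** * Extremal graphs: complete graphs and stars *)

Section Examples.
Variable n : nat.

Fact complete_adj_sym : symmetric [rel x y : 'I_n | x != y].
Proof. by move=> x y; rewrite /= eq_sym. Qed.

Fact complete_adj_irr : irreflexive [rel x y : 'I_n | x != y].
Proof. by move=> x; rewrite /= eqxx. Qed.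

Definition complete_graph : sgraph :=
  SGraph complete_adj_sym complete_adj_irr.

(** The exclusive or says that exactly one end is the centre [ord0]; there are [n] leaves. *)
Definition star_adj_rel : rel 'I_n.+1 := [rel x y | (x == ord0) (+) (y == ord0)].

Fact star_adj_sym : symmetric star_adj_rel.
Proof. move=> x y; exact: addbC. Qed.

Fact star_adj_irr : irreflexive star_adj_rel.
Proof. move=> x; exact: addbb. Qed.

Definition star_graph : sgraph := SGraph star_adj_sym star_adj_irr.

Lemma complete_graph_connected : connected_graph complete_graph.
Proof.
apply/forallP=> x; apply/forallP=> y.
have [->|xy] := eqVneq x y; first exact: connect0.
exact: connect1.
Qed.

Lemma compl_complete_graph_disconnected :
  1 < n -> ~~ connected_graph (compl complete_graph).
Proof.
move=> n2; apply/negP=> /forallP /(_ (Ordinal (ltnW n2))).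
move=> /forallP /(_ (Ordinal n2)) /connectP[[|z p] //= /andP[]].
by rewrite /compl_adj /= andbN.
Qed.

Lemma tau_complete_graph k : 2 < k <= n -> n - k <= tau complete_graph k.
Proof.
case/andP=> k3 kn; apply: leq_tau; first exact: complete_graph_connected.
  by rewrite card_ord.
move=> S Sk; apply: leq_trans (card_common_nbrs_le_tau_set S).
have -> : n - k = #|~: S| by rewrite cardsCs setCK card_ord Sk.
apply/subset_leq_card/subsetP=> v; rewrite !inE => vS; rewrite vS.
by apply/forall_inP=> s sS /=; apply: contraNneq vS => <-.
Qed.

Lemma star_graph_connected : connected_graph star_graph.
Proof.
have c0 (x : star_graph) : connect (@adj star_graph) x ord0.
  have [->|x0] := eqVneq x ord0; first exact: connect0.
  by apply: connect1; rewrite /= /star_adj_rel /= eqxx (negPf x0).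
apply/forallP=> x; apply/forallP=> y; apply: connect_trans (c0 x) _.
by rewrite (sym_connect_sym star_adj_sym) c0.
Qed.

(** The centre is isolated in the complement, and [0 < n] provides another vertex. *)
Lemma compl_star_graph_disconnected :
  0 < n -> ~~ connected_graph (compl star_graph).
Proof.
move=> n0; apply/negP=> /forallP /(_ ord0).
move=> /forallP /(_ ord_max) /connectP[[|z p] /=].
  by move=> _ /eqP; rewrite -val_eqE /= eqn0Ngt n0.
by rewrite /compl_adj /= {1}/star_adj_rel /= [z == _]eq_sym; case: (ord0 == z).
Qed.

(** If [S] contains the centre, a leaf in [S] has no neighbour outside [S]. *)
Lemma tau_star_graph k : 2 < k <= n.+1 -> tau star_graph k = 0.
Proof.
case/andP=> k3 kn.
have [S Sk S0] : exists2 S : {set star_graph}, #|S| = k & ord0 \in S.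
  have [S Sk] : exists S : {set star_graph}, #|S| = k.
    by apply: exists_set_card; rewrite card_ord.
  have [S0|S0] := boolP ((ord0 : star_graph) \in S); first by exists S.
  have /card_gt0P[t tS] : 0 < #|S| by rewrite Sk (ltn_trans _ k3).
  (* The centre replaces some [t] in [S]. *)
  by exists (ord0 |: S :\ t); rewrite ?card_exchange ?setU11.
have /card_gt0P[s /setD1P[s0 sS]] : 0 < #|S :\ ord0|.
  by move: k3; rewrite -Sk (cardsD1 ord0 S) S0 add1n ltnS => /ltnW.
apply/eqP; rewrite -leqn0; apply: leq_trans (tau_le_outer_nbrs k3 Sk sS) _.
rewrite leqn0 cards_eq0; apply/eqP/setP=> v; rewrite !inE /= /star_adj_rel /= (negPf s0) /=.
by case: eqP => [->|]; rewrite ?S0 ?andbF.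
Qed.

End Examples.

Theorem theorem8 :
  (* the bounds *)
  (forall (k n : nat) (G : sgraph),
     3 <= k -> k <= n -> #|G| = n -> connected_graph G ->
     (0 <= tau G k + tau (compl G) k <= n - k) /\
     (0 <= tau G k * tau (compl G) k <= ((n - k) %/ 2) ^ 2)) /\
  (* sharpness of the lower and upper bounds on the sum *)
  (forall k n : nat, 3 <= k -> k <= n ->
     exists G : sgraph, [/\ #|G| = n, connected_graph G &
       tau G k + tau (compl G) k = 0]) /\
  (forall k n : nat, 3 <= k -> k <= n ->
     exists G : sgraph, [/\ #|G| = n, connected_graph G &
       tau G k + tau (compl G) k = n - k]) /\
  (* sharpness of the lower and upper bounds on the product *)
  (forall k n : nat, 3 <= k -> k <= n ->
     exists G : sgraph, [/\ #|G| = n, connected_graph G &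
       tau G k * tau (compl G) k = 0]) /\
  (forall k : nat, 3 <= k ->
     exists (n : nat) (G : sgraph), [/\ k <= n, #|G| = n, connected_graph G &
       tau G k * tau (compl G) k = ((n - k) %/ 2) ^ 2]).
Proof.
(* Star graphs make both parameters vanish, which serves both lower bounds and the product bound at
   [n = k]. *)
have star k n : 3 <= k -> k <= n ->
    exists G : sgraph, [/\ #|G| = n, connected_graph G,
      tau G k = 0 & tau (compl G) k = 0].
  case: n => [|n] k3; first by case: k k3.
  move=> kn; exists (star_graph n); split; first exact: card_ord.
  - exact: star_graph_connected.
  - by apply: tau_star_graph; rewrite k3.
  apply/tau_disconnected/compl_star_graph_disconnected.
  by rewrite -ltnS (leq_trans _ kn) // ltnW.
split; [|split; [|split; [|split]]].
- move=> k n G k3 kn En _; rewrite -En in kn *.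
  by split; [apply: tau_compl_sum | apply: tau_compl_prod].
- move=> k n k3 /(star k n k3)[G [Gn cG t tC]].
  by exists G; rewrite t tC.
- move=> k n k3 kn; exists (complete_graph n).
  split; [exact: card_ord | exact: complete_graph_connected |].
  rewrite (tau_disconnected k (compl_complete_graph_disconnected _)); last first.
    by rewrite (leq_trans _ kn) // ltnW.
  rewrite addn0; apply/eqP; rewrite eqn_leq tau_complete_graph ?k3 // andbT.
  have := @tau_compl_sum (complete_graph n) k k3; rewrite card_ord => /(_ kn).
  exact: leq_trans (leq_addr _ _).
- move=> k n k3 /(star k n k3)[G [Gn cG t tC]].
  by exists G; rewrite t tC.
(* For [n = k] both sides vanish. *)
move=> k k3; have [G [Gk cG t tC]] := star k k k3 (leqnn k).
by exists k, G; rewrite t tC subnn.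
Qed.
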